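(* Let $A$ be a real constant $n\times n$ matrix and $B=A^{T}$. Suppose $\nu^{1}$ and $\nu^{2}$ are real eigenvectors of the matrix $B$ corresponding to the distinct eigenvalues $\lambda_1$ and $\lambda_2$ ($\lambda_1\neq\lambda_2$), respectively. Then the system $\dfrac{dx}{dt}=Ax$ has the autonomous first integral $$F\colon x\mapsto |\nu^{1}x|^{h_1}\,|\nu^{2}x|^{h_2}\quad\text{for all }x\in\mathscr X,$$ where $\mathscr X$ is a domain contained in the domain of definition ${\rm D}F\subset\mathbb R^n$ of the function $F$, and the numbers $h_1,h_2$ are a real solution of the equation $\lambda_1h_1+\lambda_2h_2=0$ with $|h_1|+|h_2|\neq 0$.
   Context: A domain is an open arcwise connected set. For a vector $\nu=(\nu_1,\dots,\nu_n)$ and $x=(x_1,\dots,x_n)\in\mathbb R^n$, $\nu x=\sum_{\xi=1}^n\nu_\xi x_\xi$. An eigenvector $\nu$ of $B$ with eigenvalue $\lambda$ satisfies $B\nu=\lambda\nu$ with $\nu\neq0$ regarded as a column. An autonomous first integral of $dx/dt=Ax$ on a domain $\mathscr X\subset\mathbb R^n$ is a continuously differentiable function $F\colon\mathscr X\to\mathbb R$ with $\sum_{\xi=1}^n (Ax)_\xi\,\partial_{x_\xi}F(x)=0$ for all $x\in\mathscr X$.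
   Formalization: The domain DF of F is taken to exclude zeros of ν^i x when 0 < h_i ≤ 1 (as well as h_i < 0), since F is not continuously differentiable there: e.g. A = diag(1,−1), h_1 = h_2 = 1, F = |x_1||x_2| on the whole plane. *)

(* Defs.v *)
From HB Require Import structures.
From mathcomp Require Export all_boot all_order all_algebra.
From mathcomp Require Export all_classical all_reals all_analysis.
Export Order.TTheory GRing.Theory Num.Theory.
Export numFieldNormedType.Exports.

Set Implicit Arguments.
Unset Strict Implicit.
Unset Printing Implicit Defensive.

Local Open Scope classical_set_scope.
Local Open Scope ring_scope.

Definition arcwise_connected (R : realType) (T : topologicalType)
    (X : set T) : Prop :=
  forall x y : T, X x -> X y ->
    exists g : R -> T,
      [/\ {within `[0, 1], continuous g}, g 0 = x, g 1 = y
        & forall t : R, t \in `[0, 1] -> X (g t)].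

Definition is_domain (R : realType) (n : nat) (X : set 'cV[R]_n) : Prop :=
  open X /\ arcwise_connected R X.

Definition eigenvector (R : realType) (n : nat) (B : 'M[R]_n)
    (lambda : R) (nu : 'cV[R]_n) : Prop :=
  nu != 0 /\ B *m nu = lambda *: nu.

Definition linform (R : realType) (n : nat) (nu x : 'cV[R]_n) : R :=
  \sum_(i < n) nu i 0 * x i 0.

Definition partial_deriv (R : realType) (n : nat) (i : 'I_n)
    (F : 'cV[R]_n -> R) (x : 'cV[R]_n) : R :=
  'D_(delta_mx i 0) F x.

(* Functions on X are represented by total functions; since [is_domain X] makes
   X open, the values of F outside X are irrelevant to the notions below. *)
Definition continuously_differentiable_on (R : realType) (n : nat)
    (X : set 'cV[R]_n) (F : 'cV[R]_n -> R) : Prop :=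
  forall (x : 'cV[R]_n) (i : 'I_n), X x ->
    derivable F x (delta_mx i 0) /\
    {for x, continuous (partial_deriv i F)}.

Definition autonomous_first_integral (R : realType) (n : nat) (A : 'M[R]_n)
    (X : set 'cV[R]_n) (F : 'cV[R]_n -> R) : Prop :=
  continuously_differentiable_on X F /\
  forall x : 'cV[R]_n, X x ->
    \sum_(i < n) (A *m x) i 0 * partial_deriv i F x = 0.

Definition F_power (R : realType) (n : nat) (nu1 nu2 : 'cV[R]_n) (h1 h2 : R)
    (x : 'cV[R]_n) : R :=
  `|linform nu1 x| `^ h1 * `|linform nu2 x| `^ h2.

(* Points at which s |-> |s|^h is taken to be defined.  A nonzero s is always
   admitted (|s|^h = exp (h ln |s|)).  At s = 0 the library's total power [`^]
   has the junk value 0 for h < 0; for 0 < h <= 1 the value 0 is meaningful, but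
   the function is not continuously differentiable there, so that it cannot
   enter a first integral.  For h = 0 (constant 1) and h > 1 the function is
   continuously differentiable everywhere, and s = 0 is admitted. *)
Definition power_dom (R : realType) (h : R) : set R :=
  [set s | s != 0 \/ h = 0 \/ 1 < h].

Definition F_dom (R : realType) (n : nat) (nu1 nu2 : 'cV[R]_n) (h1 h2 : R) :
    set 'cV[R]_n :=
  [set x | power_dom h1 (linform nu1 x) /\ power_dom h2 (linform nu2 x)].

(* Main.v *)
(** Write a_k = nu^k x.  Since nu^k is an eigenvector of A^T, a_k satisfies
    (A x) . grad a_k = lambda_k a_k, and s |-> |s|^h satisfies Euler's identity
    s (|s|^h)' = h |s|^h.  Hence the derivative of F along A x is
    (lambda_1 h_1 + lambda_2 h_2) F = 0.  The points where some a_k vanishes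
    need care: there h_k = 0 or h_k > 1, and |s|^h_k is still C^1 at s = 0. *)
Require Import Defs.
From mathcomp Require Import ring.
Set Implicit Arguments.
Unset Strict Implicit.
Unset Printing Implicit Defensive.

Local Open Scope classical_set_scope.
Local Open Scope ring_scope.

(* The derivative of [s |-> |s|^h].  At [s = 0] it is [0], which is the right
   value both for [h = 0] (constant [1]) and for [h > 1]. *)
Definition abs_powR_derive (R : realType) (h s : R) : R :=
  h * Num.sg s * `|s| `^ (h - 1).

Lemma near_eq_continuous (T U : topologicalType) (f g : T -> U) (x : T) :
  (\forall y \near x, f y = g y) ->
  {for x, continuous f} -> {for x, continuous g}.
Proof.
move=> fg fx; rewrite /prop_for /continuous_at -(nbhs_singleton fg).
by apply: cvg_trans fx; apply: near_eq_cvg.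
Qed.

Lemma near_sgr (R : realType) (s : R) : s != 0 ->
  \forall t \near s, Num.sg t = Num.sg s.
Proof.
case: (ltrgtP s 0) => // s0 _.
  by near=> t; rewrite !ltr0_sg//; near: t; exact: lt_nbhsl.
by near=> t; rewrite !gtr0_sg//; near: t; exact: lt_nbhsr.
Unshelve. all: by end_near. Qed.

(** The sign is locally constant away from 0, so near [s] one has [|t| = sg s * t], and the chain
    rule for a power at the positive argument [|s|] applies. *)
Lemma is_derive_abs_powR_neq0 (R : realType) (h s : R) : s != 0 ->
  is_derive s 1 (fun t : R => `|t| `^ h) (abs_powR_derive h s).
Proof.
move=> s0.
apply: (@near_eq_is_derive _ _ _ ((fun t => t `^ h) \o (fun t => Num.sg s * t))).
  near=> t; rewrite /= normrEsg; congr ((_ * _) `^ _).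
  by apply/esym; near: t; exact: near_sgr.
have ns : Num.sg s * s = `|s| by rewrite normrEsg.
have d1 : is_derive s 1 (fun t => Num.sg s * t) (Num.sg s).
  have -> : (fun t => Num.sg s * t) = Num.sg s \*: id by [].
  by apply: is_derive_eq; rewrite /GRing.scale /= mulr1.
have d2 : is_derive (Num.sg s * s) 1 (fun t => t `^ h) (h * `|s| `^ (h - 1)).
  by rewrite -ns; apply: is_derive1_powR; rewrite ns normr_gt0.
by rewrite /abs_powR_derive mulrAC; apply: is_derive1_comp.
Unshelve. all: by end_near. Qed.

Lemma cvg_abs_powR0 (R : realType) (h : R) : 0 < h ->
  `|t| `^ h @[t --> (0 : R)] --> (0 : R).
Proof.
move=> h0; apply/cvgr0Pnorm_lt => e e0.
near=> t; rewrite ger0_norm ?powR_ge0//.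
(* Since the power is increasing, [e^(1/h)] serves as the radius for the tolerance [e]. *)
have -> : e = (e `^ h^-1) `^ h by rewrite -powRrM mulVf ?gt_eqF// powRr1// ltW.
rewrite gt0_ltr_powR ?nnegrE ?powR_ge0//.
by near: t; apply: (@nbhs0_lt R R^o); rewrite powR_gt0.
Unshelve. all: by end_near. Qed.

Lemma continuous_abs_powR (R : realType) (h s : R) : s != 0 \/ 0 < h ->
  {for s, continuous (fun t : R => `|t| `^ h)}.
Proof.
have [->|s0 _] := eqVneq s 0; last first.
  have := is_derive_abs_powR_neq0 h s0.
  by move=> [/derivable1_diffP/differentiable_continuous].
case=> // h0; rewrite /prop_for /continuous_at /= normr0 powR0 ?gt_eqF//.
exact: cvg_abs_powR0.
Qed.

Lemma is_derive_abs_powR (R : realType) (h s : R) : power_dom h s ->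
  is_derive s 1 (fun t : R => `|t| `^ h) (abs_powR_derive h s).
Proof.
have [-> hh|s0 _] := eqVneq s 0; last exact: is_derive_abs_powR_neq0.
case: hh => [/eqP//|[->|h1]].
  (* For [h = 0] the function is the constant 1, also at 0, because [0 ^ 0 = 1]. *)
  rewrite /abs_powR_derive !mul0r.
  by under eq_fun do rewrite powRr0; exact: is_derive_cst.
have h0 : 0 < h - 1 by rewrite subr_gt0.
(* For [h > 1] the difference quotient at 0, left in the unfolded form used by [derive], has norm
   [|t|^(h-1)], which tends to 0. *)
have H : t^-1 *: (`|t *: (1 : R) + 0| `^ h - `|0 : R| `^ h) @[t --> (0 : R)^']
    --> (0 : R).
  rewrite normr0 powR0 ?gt_eqF ?(lt_trans _ h1)//.
  apply/norm_cvg0P.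
  apply: cvg_trans (cvg_within_filter _ (cvg_abs_powR0 h0)).
  apply: near_eq_cvg; near=> t.
  rewrite subr0 addr0 [_ *: 1]mulr1 normrM normfV (ger0_norm (powR_ge0 _ _)).
  have t0 : `|t| != 0 by rewrite normr_eq0; near: t; exact: nbhs_dnbhs_neq.
  by rewrite powRB ?t0 ?implybT// powRr1// mulrC.
split; first by apply/cvg_ex; exists 0.
by rewrite /abs_powR_derive sgr0 mulr0 mul0r; apply: cvg_lim.
Unshelve. all: by end_near. Qed.

Lemma continuous_abs_powR_derive (R : realType) (h s : R) : power_dom h s ->
  {for s, continuous (abs_powR_derive h)}.
Proof.
have [-> hh|s0 _] := eqVneq s 0; last first.
  apply: (@near_eq_continuous _ _ (fun t => h * Num.sg s * `|t| `^ (h - 1))).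
    near=> t; congr (_ * _ * _).
    by apply/esym; near: t; exact: near_sgr.
  by apply: cvgMl_tmp; apply: continuous_abs_powR; left.
case: hh => [/eqP//|[->|h1]].
  have -> : abs_powR_derive 0 = cst (0 : R).
    by apply/funext => t; rewrite /abs_powR_derive !mul0r.
  exact: cst_continuous.
have h0 : 0 < h - 1 by rewrite subr_gt0.
rewrite /prop_for /continuous_at [X in _ --> X]/abs_powR_derive.
rewrite sgr0 mulr0 mul0r.
apply: norm_cvg0.
have H : `|h| * `|t| `^ (h - 1) @[t --> (0 : R)] --> (0 : R).
  by rewrite -[X in _ --> X](mulr0 `|h|); apply: cvgMl_tmp;
    exact: cvg_abs_powR0.
apply: cvg_trans H; apply: near_eq_cvg; near=> t.
rewrite !normrM normr_sg (ger0_norm (powR_ge0 _ _)).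
(* The norm of [sg t] is 1 except at [t = 0]; there both sides vanish, as [0 ^ (h-1) = 0] for
   [h - 1 <> 0]. *)
have [->|t0] := eqVneq t 0; last by rewrite mulr1.
by rewrite normr0 powR0 ?gt_eqF// !mulr0.
Unshelve. all: by end_near. Qed.

(** For [s <> 0], split [|s|^(h-1)] as [|s|^h / |s|] and cancel with [s * sg s = |s|]. At [s = 0]
    the right side is 0 because [h = 0] or [0 ^ h = 0]. *)
Lemma abs_powR_derive_euler (R : realType) (h s : R) : power_dom h s ->
  s * abs_powR_derive h s = h * `|s| `^ h.
Proof.
have [-> hh|s0 _] := eqVneq s 0.
  rewrite mul0r; case: hh => [/eqP//|[->|h1]]; first by rewrite mul0r.
  by rewrite normr0 powR0 ?mulr0// gt_eqF// (lt_trans _ h1).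
rewrite /abs_powR_derive powRB ?normr_eq0 ?s0 ?implybT// powRr1//.
rewrite [_ / _]mulrC -!mulrA mulrCA; congr (_ * _).
by rewrite mulrA [s * _]mulrC -normrEsg mulVKf// normr_eq0.
Qed.

Lemma linformZD (R : realType) (n : nat) (nu : 'cV[R]_n) (t : R)
    (v x : 'cV[R]_n) :
  linform nu (t *: v + x) = t * linform nu v + linform nu x.
Proof.
rewrite /linform mulr_sumr -big_split /=; apply: eq_bigr => i _.
by rewrite !mxE mulrDr mulrCA.
Qed.

Lemma linform_delta (R : realType) (n : nat) (nu : 'cV[R]_n) (i : 'I_n) :
  linform nu (delta_mx i 0) = nu i 0.
Proof.
rewrite /linform (bigD1 i)//= mxE !eqxx mulr1 big1 ?addr0// => j ji.
by rewrite mxE (negbTE ji) mulr0.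
Qed.

Lemma continuous_linform (R : realType) (n : nat) (nu : 'cV[R]_n) :
  continuous (linform nu).
Proof.
apply: continuous_big => [|i _ x]; first exact: add_continuous.
have cx := @coord_continuous R n 1 i 0 x.
exact: (cvgMl_tmp (a := nu i 0) cx).
Qed.

(** The sum is [nu^T (A x) = (A^T nu)^T x], and [A^T nu = lambda nu]. *)
Lemma linform_eigenvector (R : realType) (n : nat) (A : 'M[R]_n)
    (lambda : R) (nu x : 'cV[R]_n) : eigenvector A^T lambda nu ->
  \sum_(i < n) (A *m x) i 0 * nu i 0 = lambda * linform nu x.
Proof.
move=> [_ Anu].
have E (y : 'cV[R]_n) : linform nu y = (nu^T *m y) 0 0.
  by rewrite mxE; apply: eq_bigr => i _; rewrite mxE.
under eq_bigr do rewrite mulrC.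
rewrite -/(linform nu (A *m x)) !E mulmxA -[A]trmxK -trmx_mul Anu.
by rewrite linearZ /= -scalemxAl mxE.
Qed.

(** On the line [t v + x] the composite is the one-variable function [f (t c + s)], so the
    one-variable chain rule suffices. *)
Lemma is_derive_comp_linform (R : realType) (n : nat) (nu x v : 'cV[R]_n)
    (f : R -> R) (df : R) :
  is_derive (linform nu x) 1 f df ->
  is_derive x v (f \o linform nu) (df * linform nu v).
Proof.
move=> dfx; set c := linform nu v; set s := linform nu x.
have dg : is_derive (0 : R) 1 (f \o (fun t => t * c + s)) (df * c).
  apply: is_derive1_comp; first by rewrite mul0r add0r.
  have -> : (fun t => t * c + s) = c \*: id + cst s.
    by apply/funext => t; rewrite mulrC.
  by apply: is_derive_eq; rewrite /GRing.scale /= mulr1 addr0.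
set g := f \o _ in dg.
(* The two difference quotients are equal as functions of [t]; both the existence and the value of
   the limit carry over. *)
have E : (fun t => t^-1 *:
      (((f \o linform nu) \o shift x) (t *: v) - (f \o linform nu) x)) =
    (fun t => t^-1 *: ((g \o shift 0) (t *: 1) - g 0)).
  by apply/funext => t; rewrite /g /= linformZD addr0 [_ *: 1]mulr1 mul0r add0r.
case: dg => [dg dgE].
by split; [rewrite /derivable E | rewrite /derive E].
Qed.

(** The partial derivative as product and chain rule give it, with the terms in the order produced
    by [is_deriveM]. *)
Definition F_power_partial (R : realType) (n : nat) (nu1 nu2 : 'cV[R]_n)
    (h1 h2 : R) (i : 'I_n) (x : 'cV[R]_n) : R :=
  `|linform nu1 x| `^ h1 * (abs_powR_derive h2 (linform nu2 x) * nu2 i 0) +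
  `|linform nu2 x| `^ h2 * (abs_powR_derive h1 (linform nu1 x) * nu1 i 0).

Lemma is_derive_F_power (R : realType) (n : nat) (nu1 nu2 : 'cV[R]_n)
    (h1 h2 : R) (i : 'I_n) (x : 'cV[R]_n) : F_dom nu1 nu2 h1 h2 x ->
  is_derive x (delta_mx i 0) (F_power nu1 nu2 h1 h2)
    (F_power_partial nu1 nu2 h1 h2 i x).
Proof.
move=> [p1 p2].
(* Reading [nu i 0] as the linear form at the basis vector gives the shape of the chain rule
   above. *)
rewrite /F_power_partial -!linform_delta.
apply: (@is_deriveM _ _ ((fun s : R => `|s| `^ h1) \o linform nu1)
  ((fun s : R => `|s| `^ h2) \o linform nu2));
  by apply: is_derive_comp_linform; exact: is_derive_abs_powR.
Qed.

Lemma continuous_F_power_partial (R : realType) (n : nat)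
    (nu1 nu2 : 'cV[R]_n) (h1 h2 : R) (i : 'I_n) (x : 'cV[R]_n) :
  F_dom nu1 nu2 h1 h2 x ->
  {for x, continuous (F_power_partial nu1 nu2 h1 h2 i)}.
Proof.
have cp (nu : 'cV[R]_n) h : power_dom h (linform nu x) ->
    {for x, continuous (fun y => `|linform nu y| `^ h)}.
  move=> /is_derive_abs_powR[/derivable1_diffP/differentiable_continuous cf _].
  exact: (continuous_comp (@continuous_linform _ _ nu x) cf).
have cd (nu : 'cV[R]_n) h : power_dom h (linform nu x) ->
    {for x, continuous (fun y => abs_powR_derive h (linform nu y))}.
  move=> /continuous_abs_powR_derive cf.
  exact: (continuous_comp (@continuous_linform _ _ nu x) cf).
move=> [p1 p2].
have cc c : {for x, continuous (fun=> c : R)} by exact: cst_continuous.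
exact: (continuousD
  (continuousM (cp _ _ p1) (continuousM (cd _ _ p2) (cc (nu2 i 0))))
  (continuousM (cp _ _ p2) (continuousM (cd _ _ p1) (cc (nu1 i 0))))).
Qed.

Theorem theorem1p1 (R : realType) (n : nat) (A : 'M[R]_n)
  (nu1 nu2 : 'cV[R]_n) (lambda1 lambda2 : R)
  (hnu1 : eigenvector A^T lambda1 nu1)
  (hnu2 : eigenvector A^T lambda2 nu2)
  (hlambda : lambda1 <> lambda2)
  (h1 h2 : R)
  (hsol : lambda1 * h1 + lambda2 * h2 = 0)
  (hnz : `|h1| + `|h2| <> 0)
  (X : set 'cV[R]_n)
  (hX : is_domain X)
  (hXF : X `<=` F_dom nu1 nu2 h1 h2) :
  autonomous_first_integral A X (F_power nu1 nu2 h1 h2).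
Proof.
have partialE i x : X x -> partial_deriv i (F_power nu1 nu2 h1 h2) x =
    F_power_partial nu1 nu2 h1 h2 i x.
  by move=> /hXF/(is_derive_F_power i)[].
split=> [x i Xx|x Xx].
  split; first by have [] := is_derive_F_power i (hXF _ Xx).
  have cF := continuous_F_power_partial (i := i) (hXF _ Xx).
  (* The partial derivative is known to equal the formula only on [X]; as [X] is open, this holds
     near [x]. *)
  apply: (near_eq_continuous _ cF).
  near=> y; apply/esym/partialE.
  by near: y; apply: open_nbhs_nbhs; split=> //; case: hX.
have [p1 p2] := hXF _ Xx.
set a1 := linform nu1 x in p1 *; set a2 := linform nu2 x in p2 *.
(* Regroup the derivative along [A x] so that the sums [(A x) . nu^k] become [lambda_k a_k]. *)
transitivity ((`|a1| `^ h1 * abs_powR_derive h2 a2) *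
    (\sum_(i < n) (A *m x) i 0 * nu2 i 0) +
    (`|a2| `^ h2 * abs_powR_derive h1 a1) *
    (\sum_(i < n) (A *m x) i 0 * nu1 i 0)).
  rewrite !mulr_sumr -big_split /=; apply: eq_bigr => i _.
  rewrite partialE// /F_power_partial -/a1 -/a2 mulrDr; congr (_ + _).
    by rewrite mulrCA -mulrA; congr (_ * _); rewrite mulrCA.
  by rewrite mulrCA -mulrA; congr (_ * _); rewrite mulrCA.
rewrite (linform_eigenvector _ hnu1) (linform_eigenvector _ hnu2) -/a1 -/a2.
(* Move each [a_k] next to the derivative at [a_k], ready for Euler's identity. *)
have -> : `|a1| `^ h1 * abs_powR_derive h2 a2 * (lambda2 * a2) =
    `|a1| `^ h1 * lambda2 * (a2 * abs_powR_derive h2 a2) by ring.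
have -> : `|a2| `^ h2 * abs_powR_derive h1 a1 * (lambda1 * a1) =
    `|a2| `^ h2 * lambda1 * (a1 * abs_powR_derive h1 a1) by ring.
rewrite !abs_powR_derive_euler//.
transitivity ((lambda1 * h1 + lambda2 * h2) * (`|a1| `^ h1 * `|a2| `^ h2)).
  by ring.
by rewrite hsol mul0r.
Unshelve. all: by end_near. Qed.
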